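(* Let $Q=(q_1,\dots,q_n)$ with $q_i\in\mathbb C\setminus\{0,1\}$ and $\Lambda=(\lambda_{ij})$ an $n\times n$ matrix over $\mathbb C\setminus\{0\}$ with $\lambda_{ii}=1$, $\lambda_{ij}=\lambda_{ji}^{-1}$; let $G(Q,\Lambda)$ be the subgroup of $\mathbb C^\times$ generated by all $q_i,\lambda_{ij}$ and assume it is torsion free, free abelian of rank $r$ with fixed basis $\eta_1,\dots,\eta_r$. Fix a $\mathbb Q$-linearly independent set $\{\mu_1,\dots,\mu_r\}\subset\mathbb C$ and $q\in\mathbb C\setminus\{0,1\}$ not a root of unity. Let $e_i\in\mathbb C[t]$ be the unique polynomial of degree $\le2$ with $e_i(q)=\eta_i$, $e_i(1)=1$, $e_i'(1)=\mu_i$; let $\mathbb F=\mathbb C[t,t^{-1}][e_1^{-1},\dots,e_r^{-1}]$, and define the group monomorphism $c\mapsto\widetilde c$ from $G(Q,\Lambda)$ to the units of $\mathbb F$ by $\widetilde{\eta_1^{s_1}\cdots\eta_r^{s_r}}=e_1^{s_1}\cdots e_r^{s_r}$. Let $A$ be the $\mathbb F$-algebra generated by $y_1,x_1,\dots,y_n,x_n$ with relations, for $1\le i<j\le n$, $$y_jy_i=\widetilde\lambda_{ji}y_iy_j,\ \ y_jx_i=\widetilde\lambda_{ij}x_iy_j,\ \ x_jy_i=\widetilde q_i\widetilde\lambda_{ij}y_ix_j,\ \ x_jx_i=\widetilde q_i^{-1}\widetilde\lambda_{ij}^{-1}x_ix_j,$$ and for $1\le i\le n$, $x_iy_i-\widetilde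 q_iy_ix_i=(\widetilde q_i-1)\bigl(1+\sum_{k=1}^{i-1}y_kx_k\bigr)$. Then: (1) $\widetilde q_i'(1)\neq0$ for all $i=1,\dots,n$; (2) the matrix $(\widetilde\lambda_{ij}'(1))$ is a skew-symmetric $n\times n$ matrix over $\mathbb C$; (3) $A_1:=A/(t-1)A$ is commutative, and with the Poisson bracket $\{\bar a,\bar b\}=\overline{(t-1)^{-1}(ab-ba)}$ it is the Poisson algebra $\mathbb C[y_1,x_1,\dots,y_n,x_n]$ (polynomial ring) with bracket given by, for $1\le i<j\le n$, $$\{y_j,y_i\}=\widetilde\lambda_{ji}'(1)y_iy_j,\quad\{y_j,x_i\}=\widetilde\lambda_{ij}'(1)x_iy_j,\quad\{x_j,y_i\}=(\widetilde q_i'(1)+\widetilde\lambda_{ij}'(1))y_ix_j,\quad\{x_j,x_i\}=-(\widetilde q_i'(1)+\widetilde\lambda_{ij}'(1))x_ix_j,$$ and for $1\le i\le n$, $\{x_i,y_i\}=\widetilde q_i'(1)\bigl(1+\sum_{k=1}^{i}y_kx_k\bigr)$.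
   Context: Primes denote formal derivatives in $t$, evaluated at $t=1$. Here $t-1$ is a nonzero, nonunit, non-zero-divisor of $A$, so the bracket on the commutative algebra $A/(t-1)A$ is well defined. $A_1$ is called the multi-parameter Poisson Weyl algebra. *)

(* Defs.v *)
From HB Require Import structures.
From Stdlib Require Import ClassicalEpsilon.
From mathcomp Require Import all_boot all_order all_algebra.
From mathcomp Require Import fraction.
From mathcomp Require Import mpoly.
From mathcomp Require Import complex.
From mathcomp Require Import reals.
Set Implicit Arguments. Unset Strict Implicit. Unset Printing Implicit Defensive.
Import Order.TTheory GRing.Theory Num.Theory.
Local Open Scope ring_scope.

Notation "x %:F" := (@FracField.tofrac _ x) : ring_scope.

Section Defs.
Variable C : fieldType.
Local Notation K := {fraction {poly C}}.

Definition has_value1 (f : K) (v : C) : Prop :=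
  exists p qd : {poly C}, qd.[1] != 0 /\ f = p%:F / qd%:F /\ v = p.[1] / qd.[1].

Definition has_deriv1 (f : K) (d : C) : Prop :=
  exists p qd : {poly C}, qd.[1] != 0 /\ f = p%:F / qd%:F /\
    d = ((p^`()).[1] * qd.[1] - p.[1] * (qd^`()).[1]) / (qd.[1] ^+ 2).

Definition ev1 (f : K) : C := epsilon (inhabits 0) (has_value1 f).
Definition deriv1 (f : K) : C := epsilon (inhabits 0) (has_deriv1 f).

Definition zprod r (eta : 'I_r -> C) (s : 'I_r -> int) : C :=
  \prod_(j < r) eta j ^ s j.

Definition etil r (e : 'I_r -> {poly C}) (s : 'I_r -> int) : K :=
  \prod_(j < r) ((e j)%:F) ^ s j.

Definition inF r (e : 'I_r -> {poly C}) (f : K) : Prop :=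
  exists (p : {poly C}) (k : nat) (s : 'I_r -> nat),
    f = p%:F / (('X^k * \prod_(j < r) e j ^+ s j)%:F).
End Defs.

Section Rels.
Variables (Fr : comUnitRingType) (n : nat) (tq : 'I_n -> Fr) (tl : 'I_n -> 'I_n -> Fr).

Definition rels (B : algType Fr) (y x : 'I_n -> B) : Prop :=
  (forall i j : 'I_n, (i < j)%N ->
     [/\ y j * y i = tl j i *: (y i * y j),
         y j * x i = tl i j *: (x i * y j),
         x j * y i = (tq i * tl i j) *: (y i * x j)
       & x j * x i = (tq i * tl i j)^-1 *: (x i * x j)]) /\
  (forall i : 'I_n,
     x i * y i - tq i *: (y i * x i)
       = (tq i - 1) *: (1 + \sum_(k < n | (k < i)%N) y k * x k)).

Definition presented (A : algType Fr) (y x : 'I_n -> A) : Prop :=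
  rels y x /\
  forall (B : algType Fr) (yb xb : 'I_n -> B), rels yb xb ->
    exists f : {lrmorphism A -> B},
      [/\ forall i, f (y i) = yb i, forall i, f (x i) = xb i &
          forall g : {lrmorphism A -> B},
            (forall i, g (y i) = yb i) -> (forall i, g (x i) = xb i) -> g =1 f].
End Rels.

Section Poisson.
Variables (C : fieldType) (n : nat) (qp : 'I_n -> C) (lp : 'I_n -> 'I_n -> C).
Local Notation P := {mpoly C[n + n]}.

(* generator index: false = y, true = x *)
Definition gen (a : bool) (i : 'I_n) : 'I_(n + n) :=
  if a then rshift n i else lshift n i.
Definition Yv (i : 'I_n) : P := 'X_(gen false i).
Definition Xv (i : 'I_n) : P := 'X_(gen true i).

(* {a_j, b_i} for i < j *)
Definition brk_lt (a : bool) (j : 'I_n) (b : bool) (i : 'I_n) : P :=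
  match a, b with
  | false, false => lp j i *: (Yv i * Yv j)
  | false, true  => lp i j *: (Xv i * Yv j)
  | true, false  => (qp i + lp i j) *: (Yv i * Xv j)
  | true, true   => - (qp i + lp i j) *: (Xv i * Xv j)
  end.

Definition brk_diag (a : bool) (i : 'I_n) (b : bool) : P :=
  let v := qp i *: (1 + \sum_(k < n | (k <= i)%N) Yv k * Xv k) in
  match a, b with
  | true, false => v
  | false, true => - v
  | _, _ => 0
  end.

Definition gbrk (a : bool) (j : 'I_n) (b : bool) (i : 'I_n) : P :=
  if (i < j)%N then brk_lt a j b i
  else if (j < i)%N then - brk_lt b i a j
  else brk_diag a j b.

(* the biderivation extending the table *)
Definition pbracket (f g : P) : P :=
  \sum_(a : bool) \sum_(j < n) \sum_(b : bool) \sum_(i < n)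
     (f^`M(gen a j) * g^`M(gen b i)) * gbrk a j b i.
End Poisson.

(* Main.v *)
(* Write eps for a square-zero variable. The ring C[y,x][eps] with product
   f * g + (eps/2){f,g} is associative, because half the bracket is a
   biderivation, hence a Hochschild 2-cocycle. Letting c in F act on it through
   its 1-jet c(1) + c'(1) eps at t = 1, the elements y_i, x_i satisfy the
   relations of A, so the presentation yields a morphism Phi from A. Its
   reduction pi modulo eps is the quotient map, and since Phi sends t - 1 to eps,
   comparing the eps-components of Phi (ab - ba) = Phi ((t-1)c) gives
   {pi a, pi b} = pi c; in particular no basis of A over F is needed.
   For the kernel: A is generated by the y_i, x_i, which commute modulo t - 1,
   so every element of A is modulo t - 1 an F-combination of ordered monomials,
   and a coefficient vanishing at t = 1 is a multiple of t - 1 in F. *)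

Require Import Defs.
From HB Require Import structures.
From Stdlib Require Import ClassicalEpsilon.
From mathcomp Require Import all_boot all_order all_algebra.
From mathcomp Require Import fraction mpoly complex reals.
From mathcomp Require Import ring.
Set Implicit Arguments. Unset Strict Implicit. Unset Printing Implicit Defensive.
Import Order.TTheory GRing.Theory Num.Theory.
Local Open Scope ring_scope.

(** * First-order jets at $t=1$ of rational functions *)

Section JetsAtOne.
Variable C : fieldType.
Local Notation K := {fraction {poly C}}.
Implicit Types (f g : K) (p q : {poly C}) (v d : C).

(** One fraction witnesses both value and derivative, whereas [has_value1] and [has_deriv1] each
    pick their own; the product rule needs the shared one. *)
Definition jet1 f v d : Prop :=
  exists p q, [/\ q.[1] != 0, f = p%:F / q%:F, v = p.[1] / q.[1] &
    d = (p^`().[1] * q.[1] - p.[1] * q^`().[1]) / q.[1] ^+ 2].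

Lemma horner_neq0 p : p.[1] != 0 -> p != 0.
Proof. by apply: contraNneq => ->; rewrite horner0. Qed.

Lemma tofrac_neq0 p : p.[1] != 0 -> p%:F != 0.
Proof. by move=> /horner_neq0; rewrite tofrac_eq0. Qed.

Lemma jet1_frac p q : q.[1] != 0 ->
  jet1 (p%:F / q%:F) (p.[1] / q.[1])
    ((p^`().[1] * q.[1] - p.[1] * q^`().[1]) / q.[1] ^+ 2).
Proof. by move=> q1; exists p, q. Qed.

(** Cross-multiply the fractions, then evaluate and differentiate [p * q' = p' * q] at $1$.
    Uniqueness is what pins down the [epsilon] choices in [ev1] and [deriv1]. *)
Lemma jet1_unique f v d v' d' : jet1 f v d -> jet1 f v' d' -> v = v' /\ d = d'.
Proof.
move=> [p [q [q1 -> -> ->]]] [p' [q' [q'1 E -> ->]]].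
have {}E : p * q' = p' * q.
  apply/eqP; rewrite -tofrac_eq !rmorphM /=.
  by rewrite -eqr_div ?tofrac_neq0 // E.
have E1 : p.[1] * q'.[1] = p'.[1] * q.[1] by rewrite -!hornerM E.
have E2 : p^`().[1] * q'.[1] + p.[1] * q'^`().[1]
        = p'^`().[1] * q.[1] + p'.[1] * q^`().[1].
  by rewrite -!hornerM -!hornerD -!derivM E.
split; first by apply/eqP; rewrite eqr_div // E1.
have p1E : p.[1] = p'.[1] * q.[1] / q'.[1] by rewrite -E1 mulfK.
have p'1E : p^`().[1] = (p'^`().[1] * q.[1] + p'.[1] * q^`().[1]
    - p.[1] * q'^`().[1]) / q'.[1] by rewrite -E2 addrK mulfK.
by rewrite p'1E p1E; field; rewrite q1 q'1.
Qed.

Lemma jet1_value1 f v d : jet1 f v d -> has_value1 f v.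
Proof. by move=> [p [q [q1 -> -> _]]]; exists p, q. Qed.

Lemma jet1_ev1 f v d : jet1 f v d -> ev1 f = v.
Proof.
move=> J; have := epsilon_spec (inhabits 0) (has_value1 f)
  (ex_intro _ v (jet1_value1 J)).
rewrite -/(ev1 f) => -[p [q [q1 [E ->]]]].
have := jet1_frac p q1; rewrite -E => J'.
by case: (jet1_unique J' J).
Qed.

Lemma jet1_deriv1 f v d : jet1 f v d -> deriv1 f = d.
Proof.
move=> J; have /(epsilon_spec (inhabits 0)) : exists c, has_deriv1 f c.
  by case: J => [p [q [q1 E _ Ed]]]; exists d, p, q.
rewrite -/(deriv1 f) => -[p [q [q1 [E ->]]]].
have := jet1_frac p q1; rewrite -E => J'.
by case: (jet1_unique J' J).
Qed.

Lemma jet1_poly p : jet1 p%:F p.[1] p^`().[1].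
Proof.
have E1 : (1 : {poly C}).[1] = 1 by rewrite hornerE.
have := @jet1_frac p 1; rewrite E1 oner_eq0 => /(_ isT).
by rewrite rmorph1 !divr1 derivC horner0 expr1n mulr0 subr0 mulr1 divr1.
Qed.

Lemma jet1_1 : jet1 1 1 0.
Proof. by have := jet1_poly 1; rewrite rmorph1 derivC horner0 hornerE. Qed.

Lemma jet1_0 : jet1 0 0 0.
Proof. by have := jet1_poly 0; rewrite rmorph0 linear0 horner0. Qed.

Lemma jet1D f g v d v' d' :
  jet1 f v d -> jet1 g v' d' -> jet1 (f + g) (v + v') (d + d').
Proof.
move=> [p [q [q1 -> -> ->]]] [p' [q' [q'1 -> -> ->]]].
exists (p * q' + p' * q), (q * q'); split.
- by rewrite hornerM mulf_neq0.
- by rewrite addf_div ?tofrac_neq0 // rmorphD !rmorphM.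
- by rewrite addf_div // !hornerE.
- by rewrite !(derivD, derivM) !(hornerD, hornerM); field; rewrite q1 q'1.
Qed.

Lemma jet1M f g v d v' d' :
  jet1 f v d -> jet1 g v' d' -> jet1 (f * g) (v * v') (v * d' + d * v').
Proof.
move=> [p [q [q1 -> -> ->]]] [p' [q' [q'1 -> -> ->]]].
exists (p * p'), (q * q'); split.
- by rewrite hornerM mulf_neq0.
- by rewrite mulf_div !rmorphM.
- by rewrite mulf_div !hornerE.
- by rewrite !derivM !(hornerD, hornerM); field; rewrite q1 q'1.
Qed.

Lemma jet1V f v d : v != 0 -> jet1 f v d -> jet1 f^-1 v^-1 (- d / v ^+ 2).
Proof.
move=> v0 [p [q [q1 -> Ev ->]]].
have p1 : p.[1] != 0 by apply: contraNneq v0 => p0; rewrite Ev p0 mul0r.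
exists q, p; split; rewrite ?Ev ?invf_div //.
by field; rewrite p1 q1.
Qed.

Lemma jet1_exprz p (z : int) : p.[1] = 1 -> jet1 (p%:F ^ z) 1 (z%:~R * p^`().[1]).
Proof.
move=> p1; have J (k : nat) : jet1 (p%:F ^+ k) 1 (k%:R * p^`().[1]).
  elim: k => [|k IH]; first by rewrite expr0 mul0r; exact: jet1_1.
  rewrite exprS; have := jet1M (jet1_poly p) IH.
  by rewrite p1 !mul1r mulr1 -[k.+1]addn1 natrD mulrDl mul1r.
case: z => k; first exact: J.
have := jet1V (oner_neq0 _) (J k.+1).
by rewrite invr1 expr1n divr1 NegzE mulrNz mulNr.
Qed.

(** All factors have value $1$, so differentiating at $1$ acts like a logarithmic derivative: the
    result is linear in the exponents. *)
Lemma jet1_etil r (e : 'I_r -> {poly C}) (s : 'I_r -> int) :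
    (forall k, (e k).[1] = 1) ->
  jet1 (etil e s) 1 (\sum_(k < r) (s k)%:~R * (e k)^`().[1]).
Proof.
move=> e1; rewrite /etil.
elim/big_ind2: _ => [|f d g d' Jf Jg|k _]; first exact: jet1_1.
- by have := jet1M Jf Jg; rewrite !mul1r mulr1 addrC.
- exact: jet1_exprz.
Qed.

Lemma inF_denom_neq0 r (e : 'I_r -> {poly C}) k (s : 'I_r -> nat) :
  (forall j, (e j).[1] = 1) -> ('X^k * \prod_(j < r) e j ^+ s j).[1] != 0.
Proof.
move=> e1; rewrite hornerM hornerXn expr1n mul1r horner_prod.
rewrite big1 ?oner_eq0 // => j _.
by rewrite horner_exp e1 expr1n.
Qed.

(** The denominators allowed in $\mathbb F$ do not vanish at $t=1$, so every element of $\mathbb F$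
    has a jet there. *)
Lemma jet1_inF r (e : 'I_r -> {poly C}) f : (forall k, (e k).[1] = 1) ->
  inF e f -> jet1 f (ev1 f) (deriv1 f).
Proof.
move=> e1 [p [k [s ->]]].
have D1 := inF_denom_neq0 k s e1.
have J := jet1_frac p D1.
by rewrite (jet1_ev1 J) (jet1_deriv1 J).
Qed.

(** The factor theorem takes $t-1$ out of the numerator; the denominator is kept, so the quotient
    stays in $\mathbb F$. *)
Lemma inF_ev1_eq0 r (e : 'I_r -> {poly C}) f : (forall k, (e k).[1] = 1) ->
  inF e f -> ev1 f = 0 -> exists2 g, inF e g & f = ('X - 1)%:F * g.
Proof.
move=> e1 [p [k [s Ef]]]; rewrite {}Ef.
have D1 := inF_denom_neq0 k s e1.
rewrite (jet1_ev1 (jet1_frac p D1)) => /eqP.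
rewrite mulf_eq0 invr_eq0 (negPf D1) orbF => /factor_theorem[p' Ep].
exists (p'%:F / ('X^k * \prod_(j < r) e j ^+ s j)%:F); first by exists p', k, s.
by rewrite mulrA -rmorphM /= Ep polyC1 [p' * _]mulrC.
Qed.
End JetsAtOne.

(** * Square-zero deformation along a biderivation *)

Section Deformation.
Variables (Fr : comUnitRingType) (C : fieldType) (P : comAlgType C).

Record bider := Bider {
  bider_fun :> P -> P -> P;
  biderDl : forall f g h, bider_fun (f + g) h = bider_fun f h + bider_fun g h;
  biderDr : forall f g h, bider_fun h (f + g) = bider_fun h f + bider_fun h g;
  biderZl : forall c f h, bider_fun (c *: f) h = c *: bider_fun f h;
  biderZr : forall c f h, bider_fun h (c *: f) = c *: bider_fun h f;
  biderMl : forall f g h, bider_fun (f * g) h = f * bider_fun g h + bider_fun f h * g;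
  biderMr : forall f g h, bider_fun h (f * g) = f * bider_fun h g + bider_fun h f * g }.

(* Equivalently, a morphism from [Fr] to the dual numbers over [C]. *)
Record pder := Pder {
  pval : {rmorphism Fr -> C};
  pder_fun :> Fr -> C;
  pderD : forall f g, pder_fun (f + g) = pder_fun f + pder_fun g;
  pderM : forall f g, pder_fun (f * g) = pval f * pder_fun g + pder_fun f * pval g }.

Variables (th : bider) (D : pder).

Lemma bider1l h : th 1 h = 0.
Proof.
have := biderMl th 1 1 h; rewrite !mul1r mulr1 => /eqP.
by rewrite -[X in X == _]addr0 (inj_eq (addrI _)) => /eqP.
Qed.

Lemma bider1r h : th h 1 = 0.
Proof.
have := biderMr th 1 1 h; rewrite !mul1r mulr1 => /eqP.
by rewrite -[X in X == _]addr0 (inj_eq (addrI _)) => /eqP.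
Qed.

Lemma pder1 : D 1 = 0.
Proof.
have := pderM D 1 1; rewrite rmorph1 !mul1r mulr1 => /eqP.
by rewrite -[X in X == _]addr0 (inj_eq (addrI _)) => /eqP.
Qed.

(* [P[eps]/(eps^2)] with product [f * g + eps * th f g]: a biderivation is a
   Hochschild 2-cocycle, so this product is associative. A scalar [c] acts as
   [pval D c + D c * eps]. *)
Definition deform (_ : bider) (_ : pder) : Type := (P * P)%type.
Local Notation B := (deform th D).
HB.instance Definition _ := GRing.Zmodule.on B.

Definition deform_mul (a b : B) : B := (a.1 * b.1, a.1 * b.2 + a.2 * b.1 + th a.1 b.1).

Fact deform_mulA : associative deform_mul.
Proof.
move=> [a0 a1] [b0 b1] [c0 c1]; congr (_, _) => /=; first by rewrite mulrA.
by rewrite biderMl biderMr; ring.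
Qed.
Fact deform_mul1 : left_id (1 : P, 0 : P) deform_mul.
Proof. by move=> [a0 a1]; congr (_, _) => /=; rewrite ?bider1l; ring. Qed.
Fact deform_mulr1 : right_id (1 : P, 0 : P) deform_mul.
Proof. by move=> [a0 a1]; congr (_, _) => /=; rewrite ?bider1r; ring. Qed.
Fact deform_mulDl : left_distributive deform_mul +%R.
Proof.
by move=> [a0 a1] [b0 b1] [c0 c1]; congr (_, _) => /=; rewrite ?biderDl; ring.
Qed.
Fact deform_mulDr : right_distributive deform_mul +%R.
Proof.
by move=> [a0 a1] [b0 b1] [c0 c1]; congr (_, _) => /=; rewrite ?biderDr; ring.
Qed.
Fact deform_1_neq0 : (1 : P, 0 : P) != 0 :> B.
Proof. by apply/eqP => -[] /eqP; rewrite oner_eq0. Qed.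

HB.instance Definition _ := GRing.Zmodule_isNzRing.Build B
  deform_mulA deform_mul1 deform_mulr1 deform_mulDl deform_mulDr deform_1_neq0.

Definition deform_scale (c : Fr) (a : B) : B :=
  (pval D c *: a.1, pval D c *: a.2 + D c *: a.1).

Fact deform_scaleA c d a : deform_scale c (deform_scale d a) = deform_scale (c * d) a.
Proof.
case: a => a0 a1; congr (_, _); rewrite /= ?pderM rmorphM ?scalerA //.
by rewrite scalerDr !scalerA scalerDl -addrA.
Qed.
Fact deform_scale1 : left_id 1 deform_scale.
Proof.
by case=> a0 a1; congr (_, _); rewrite /= rmorph1 ?pder1 ?scale0r ?addr0 scale1r.
Qed.
Fact deform_scaleDr : right_distributive deform_scale +%R.
Proof.
by move=> c [a0 a1] [b0 b1]; congr (_, _); rewrite /= !scalerDr // addrACA.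
Qed.
Fact deform_scaleDl a : {morph deform_scale^~ a : c d / c + d}.
Proof.
move=> c d; case: a => a0 a1; congr (_, _); rewrite /= rmorphD ?pderD !scalerDl //.
by rewrite addrACA.
Qed.

HB.instance Definition _ := GRing.Zmodule_isLmodule.Build Fr B
  deform_scaleA deform_scale1 deform_scaleDr deform_scaleDl.

Fact deform_scaleAl c (a b : B) : c *: (a * b) = c *: a * b.
Proof.
case: a b => [a0 a1] [b0 b1]; congr (_, _); rewrite /= ?scalerAl //.
rewrite biderZl !scalerDr !scalerAl mulrDl -!addrA; congr (_ + (_ + _)).
by rewrite addrC.
Qed.
HB.instance Definition _ := GRing.Lmodule_isLalgebra.Build Fr B deform_scaleAl.

Fact deform_scaleAr c (a b : B) : c *: (a * b) = a * (c *: b).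
Proof.
case: a b => [a0 a1] [b0 b1]; congr (_, _); rewrite /= ?scalerAr //.
rewrite biderZr !scalerDr mulrDr -!scalerAr -!addrA; congr (_ + _).
by rewrite addrA addrC.
Qed.
HB.instance Definition _ := GRing.Lalgebra_isAlgebra.Build Fr B deform_scaleAr.

Lemma deformM (a b : B) : a * b = (a.1 * b.1, a.1 * b.2 + a.2 * b.1 + th a.1 b.1).
Proof. by []. Qed.

Lemma deformZ c (a : B) : c *: a = (pval D c *: a.1, pval D c *: a.2 + D c *: a.1).
Proof. by []. Qed.

Definition deform_fst (a : B) : P := a.1.
Fact deform_fst_is_zmod_morphism : zmod_morphism deform_fst.
Proof. by []. Qed.
Fact deform_fst_is_monoid_morphism : monoid_morphism deform_fst.
Proof. by []. Qed.
HB.instance Definition _ :=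
  GRing.isZmodMorphism.Build B P deform_fst deform_fst_is_zmod_morphism.
HB.instance Definition _ :=
  GRing.isMonoidMorphism.Build B P deform_fst deform_fst_is_monoid_morphism.

End Deformation.

(** * Generation of a presented algebra by its generators *)

Section Generation.
Variables (Fr : comUnitRingType) (n : nat) (tq : 'I_n -> Fr) (tl : 'I_n -> 'I_n -> Fr).
Variables (A : algType Fr) (y x : 'I_n -> A).

Section Subalgebra.
Variable S : A -> Prop.
Hypothesis S1 : S 1.
Hypothesis SD : forall a b, S a -> S b -> S (a + b).
Hypothesis SM : forall a b, S a -> S b -> S (a * b).
Hypothesis SZ : forall c a, S a -> S (c *: a).

(** Excluded middle turns the propositional [S] into the boolean predicate on which subalgebra
    structures are built. *)
Definition in_subalg : {pred A} :=
  fun a => if excluded_middle_informative (S a) then true else false.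

Lemma in_subalgP a : reflect (S a) (a \in in_subalg).
Proof.
by rewrite unfold_in; case: excluded_middle_informative => Sa; constructor.
Qed.

Lemma in_subalg_closed : subalg_closed in_subalg.
Proof.
split; first exact/in_subalgP.
- move=> c a b /in_subalgP Sa /in_subalgP Sb.
  by apply/in_subalgP/SD => //; apply: SZ.
- move=> a b /in_subalgP Sa /in_subalgP Sb.
  by apply/in_subalgP/SM.
Qed.

HB.instance Definition _ := GRing.isSubalgClosed.Build Fr A in_subalg in_subalg_closed.

Definition subalg := {a | a \in in_subalg}.
HB.instance Definition _ := SubChoice.on subalg.
HB.instance Definition _ := [SubChoice_isSubAlgebra of subalg by <:].

HB.instance Definition _ := GRing.RMorphism.on (\val : subalg -> A).

(* By the uniqueness clause of [presented], the endomorphism of [A] that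
   factors through [subalg] is the identity. *)
Lemma presented_subalg_full : presented tq tl y x ->
  (forall i, S (y i)) -> (forall i, S (x i)) -> forall a, S a.
Proof.
move=> [[rlt rdiag] univ] Sy Sx a.
pose ys i : subalg := exist _ (y i) (introT (in_subalgP _) (Sy i)).
pose xs i : subalg := exist _ (x i) (introT (in_subalgP _) (Sx i)).
have rS : rels tq tl ys xs.
  split=> [i j lij | i].
    by have [? ? ? ?] := rlt i j lij; split; apply: val_inj;
       rewrite linearZ.
  apply: val_inj; rewrite raddfB !linearZ /= raddfD scalerN rdiag scalerDr.
  by congr (_ + _ *: _); apply/esym/(raddf_sum (\val : subalg -> A)).
have [f [fy fx _]] := univ _ _ _ rS.
have [g [_ _ guniq]] := univ _ y x (conj rlt rdiag).
pose v : {lrmorphism subalg -> A} := \val.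
pose h : {lrmorphism A -> A} := v \o f.
have -> : a = val (f a).
  rewrite -[LHS]/(idfun a) -[RHS]/(h a) (guniq idfun) // (guniq h) // => i /=.
  - by rewrite fy.
  - by rewrite fx.
exact/in_subalgP/valP.
Qed.
End Subalgebra.
End Generation.

(** * Congruence modulo a scalar and ordered monomials *)

Section NormalForm.
Variables (Fr : comUnitRingType) (A : algType Fr) (u : Fr).

(** A scalar acts centrally, so $uA$ is a two-sided ideal; the congruence stands in for the quotient
    algebra. *)
Definition eqmod (a b : A) : Prop := exists c, a = b + u *: c.

Lemma eqmodxx a : eqmod a a.
Proof. by exists 0; rewrite scaler0 addr0. Qed.

Lemma eqmod_sym a b : eqmod a b -> eqmod b a.
Proof. by move=> [c ->]; exists (- c); rewrite scalerN addrK. Qed.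

Lemma eqmod_trans b a c : eqmod a b -> eqmod b c -> eqmod a c.
Proof. by move=> [d ->] [d' ->]; exists (d' + d); rewrite scalerDr addrA. Qed.

Lemma eqmodD a b a' b' : eqmod a b -> eqmod a' b' -> eqmod (a + a') (b + b').
Proof. by move=> [c ->] [c' ->]; exists (c + c'); rewrite scalerDr addrACA. Qed.

Lemma eqmodZ k a b : eqmod a b -> eqmod (k *: a) (k *: b).
Proof. by move=> [c ->]; exists (k *: c); rewrite scalerDr !scalerA mulrC. Qed.

Lemma eqmodM a b a' b' : eqmod a b -> eqmod a' b' -> eqmod (a * a') (b * b').
Proof.
move=> [c ->] [c' ->]; exists (b * c' + c * (b' + u *: c')).
by rewrite mulrDl mulrDr scalerDr -scalerAr -scalerAl addrA.
Qed.

Lemma eqmod_sum (I : Type) (s : seq I) (F G : I -> A) :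
  (forall i, eqmod (F i) (G i)) -> eqmod (\sum_(i <- s) F i) (\sum_(i <- s) G i).
Proof.
move=> FG; elim/big_ind2: _ => // [|a b a' b']; first exact: eqmodxx.
exact: eqmodD.
Qed.

Section Generated.
Variables (N : nat) (g : 'I_N -> A).
Hypothesis gen_ind : forall S : A -> Prop, S 1 ->
  (forall a b, S a -> S b -> S (a + b)) -> (forall a b, S a -> S b -> S (a * b)) ->
  (forall c a, S a -> S (c *: a)) -> (forall i, S (g i)) -> forall a, S a.
Hypothesis gC : forall i j, eqmod (g i * g j) (g j * g i).

(** Elements commuting with a fixed [c] modulo [u] form a subalgebra, so commuting with the
    generators suffices. This is used for [c] a generator and then for [c] arbitrary. *)
Lemma eqmod_commute a b : eqmod (a * b) (b * a).
Proof.
have closed c : (forall i, eqmod (c * g i) (g i * c)) -> forall d, eqmod (c * d) (d * c).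
  move=> cg; apply: gen_ind => // [|d d' H H'|d d' H H'|k d H].
  - by rewrite mulr1 mul1r; exact: eqmodxx.
  - by rewrite mulrDl mulrDr; exact: eqmodD.
  - apply: (@eqmod_trans (d * c * d')).
      by rewrite mulrA; apply: eqmodM => //; exact: eqmodxx.
    by rewrite -!mulrA; apply: eqmodM => //; exact: eqmodxx.
  - by rewrite -scalerAl -scalerAr; exact: eqmodZ.
by apply/closed => i; apply/eqmod_sym/closed => j; exact: gC.
Qed.

(** Each monomial becomes a product of powers in the fixed order of the indices. As [A] need not be
    commutative, multiplicativity is only available modulo [u]. *)
Definition polyval (p : {mpoly Fr[N]}) : A := mmap (in_alg A) g p.

Lemma polyvalE p : polyval p = \sum_(m <- msupp p) p@_m *: mmap1 g m.
Proof. by apply: eq_bigr => m _; rewrite /= -scalerAl mul1r. Qed.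

Lemma polyvalD p q : polyval (p + q) = polyval p + polyval q.
Proof. exact: mmapD. Qed.

Lemma polyvalZ c p : polyval (c *: p) = c *: polyval p.
Proof.
by rewrite /polyval mmapZ /= -scalerAl mul1r.
Qed.

Lemma polyvalX m : polyval 'X_[m] = mmap1 g m.
Proof. by rewrite /polyval mmapX. Qed.

Lemma eqmod_prodM (I : Type) (s : seq I) (F G : I -> A) :
  eqmod (\prod_(i <- s) (F i * G i)) ((\prod_(i <- s) F i) * \prod_(i <- s) G i).
Proof.
elim: s => [|i s IH]; first by rewrite !big_nil mulr1; exact: eqmodxx.
rewrite !big_cons; apply: (eqmod_trans (eqmodM (eqmodxx _) IH)).
rewrite -!mulrA; apply: eqmodM (eqmodxx _) _.
rewrite !mulrA; apply: eqmodM _ (eqmodxx _); exact: eqmod_commute.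
Qed.

Lemma polyval_mon m m' : eqmod (mmap1 g (m + m')) (mmap1 g m * mmap1 g m').
Proof.
rewrite /mmap1; have -> : \prod_(i < N) g i ^+ (m + m')%MM i
    = \prod_(i < N) (g i ^+ m i * g i ^+ m' i).
  by apply: eq_bigr => i _; rewrite mnmDE exprD.
exact: eqmod_prodM.
Qed.

Lemma polyvalM p q : eqmod (polyval (p * q)) (polyval p * polyval q).
Proof.
have -> : polyval (p * q) =
    \sum_(m <- msupp p) \sum_(m' <- msupp q) (p@_m * q@_m') *: mmap1 g (m + m').
  rewrite mpolyME /polyval raddf_sum /= big_allpairs /=.
  apply: eq_bigr => m _; apply: eq_bigr => m' _.
  by rewrite -/(polyval _) polyvalZ polyvalX.
rewrite !polyvalE mulr_suml; apply: eqmod_sum => m.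
rewrite mulr_sumr; apply: eqmod_sum => m'.
rewrite -scalerAl -scalerAr scalerA; apply: eqmodZ; exact: polyval_mon.
Qed.

(** The spanning half of a PBW statement, modulo [u]: the elements with such a [p] form a subalgebra
    containing the generators. *)
Lemma eqmod_polyval a : exists p, eqmod a (polyval p).
Proof.
elim/gen_ind: a => [|a b [p ap] [q bq]|a b [p ap] [q bq]|c a [p ap]|i].
- by exists 1; rewrite /polyval -mpolyC1 mmapC /= scale1r; exact: eqmodxx.
- by exists (p + q); rewrite polyvalD; exact: eqmodD.
- exists (p * q); apply: eqmod_trans (eqmodM ap bq) _.
  exact/eqmod_sym/polyvalM.
- by exists (c *: p); rewrite polyvalZ; exact: eqmodZ.
- by exists 'X_i; rewrite polyvalX mmap1U; exact: eqmodxx.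
Qed.

Variables (C : fieldType) (ev : {rmorphism Fr -> C}).
Variable pi : {rmorphism A -> {mpoly C[N]}}.
Hypothesis piZ : forall c a, pi (c *: a) = ev c *: pi a.
Hypothesis pig : forall i, pi (g i) = 'X_i.

Lemma morph_mmap1 m : pi (mmap1 g m) = 'X_[m].
Proof.
rewrite -mmap1_id /mmap1 rmorph_prod; apply: eq_bigr => i _.
by rewrite rmorphXn /= pig.
Qed.

Lemma morph_surjective : (forall c, exists d, ev d = c) -> forall P, exists a, pi a = P.
Proof.
move=> ev_surj; elim/mpolyind => [|c m P _ _ [a aP]].
  by exists 0; rewrite rmorph0.
have [d <-] := ev_surj c.
by exists (d *: mmap1 g m + a); rewrite rmorphD piZ morph_mmap1 aP.
Qed.

(** Independence of monomials is used only in the target: there it forces every coefficient of a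
    normal form of [a] to evaluate to $0$, hence to be divisible by [u]. *)
Lemma morph_kernel : (forall c, ev c = 0 -> exists d, c = u * d) -> ev u = 0 ->
  forall a, pi a = 0 -> exists b, a = u *: b.
Proof.
move=> ev0 evu a pia0.
have [p [c ac]] := eqmod_polyval a.
have pip : pi (polyval p) = map_mpoly ev p.
  rewrite polyvalE rmorph_sum /= /map_mpoly /mmap; apply: eq_bigr => m _.
  by rewrite piZ /= mul_mpolyC morph_mmap1 mmap1_id.
have p0 m : ev p@_m = 0.
  rewrite -mcoeff_map_mpoly -pip -[RHS](mcoeff0 _ m) -pia0 ac.
  by rewrite rmorphD piZ evu scale0r addr0.
have [b pb] : eqmod (polyval p) 0.
  have -> : 0 = \sum_(m <- msupp p) 0 :> A by rewrite big1.
  rewrite polyvalE.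
  apply: eqmod_sum => m; have [d ->] := ev0 _ (p0 m).
  by exists (d *: mmap1 g m); rewrite add0r scalerA.
by exists (b + c); rewrite ac pb add0r scalerDr.
Qed.
End Generated.
End NormalForm.

(** * The bracket on the polynomial ring and the relations in its deformation *)

Section Bracket.
Variables (C : fieldType) (n : nat) (qp : 'I_n -> C) (lp : 'I_n -> 'I_n -> C).
Local Notation P := {mpoly C[n + n]}.
Local Notation brk := (gbrk qp lp).
Local Notation pb := (pbracket qp lp).
Implicit Types f g h : P.

Lemma pbracketE f g : pb f g =
  \sum_(u : bool * 'I_n) \sum_(v : bool * 'I_n)
    (f^`M(gen u.1 u.2) * g^`M(gen v.1 v.2)) * brk u.1 u.2 v.1 v.2.
Proof.
rewrite /pbracket pair_bigA; apply: eq_bigr => u _.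
by rewrite pair_bigA.
Qed.

Lemma gbrk_antisym a j b i : brk a j b i = - brk b i a j.
Proof.
rewrite /gbrk; case: ltngtP => [_|_|/val_inj ->]; rewrite ?opprK //.
by case: a b => [] [] //=; rewrite ?opprK ?oppr0.
Qed.

Lemma pbracket_antisym f g : pb f g = - pb g f.
Proof.
rewrite !pbracketE exchange_big -sumrN; apply: eq_bigr => v _.
rewrite -sumrN; apply: eq_bigr => u _.
by rewrite gbrk_antisym mulrN [g^`M(_) * _]mulrC.
Qed.

Lemma pbracketDl f g h : pb (f + g) h = pb f h + pb g h.
Proof.
rewrite !pbracketE -big_split; apply: eq_bigr => u _ /=.
rewrite -big_split; apply: eq_bigr => v _ /=.
by rewrite mderivD !mulrDl.
Qed.

Lemma pbracketZl c f h : pb (c *: f) h = c *: pb f h.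
Proof.
rewrite !pbracketE scaler_sumr; apply: eq_bigr => u _ /=.
rewrite scaler_sumr; apply: eq_bigr => v _ /=.
by rewrite mderivZ -!scalerAl.
Qed.

Lemma pbracketMl f g h : pb (f * g) h = f * pb g h + pb f h * g.
Proof.
rewrite !pbracketE mulr_sumr mulr_suml -big_split; apply: eq_bigr => u _ /=.
rewrite mulr_sumr mulr_suml -big_split; apply: eq_bigr => v _ /=.
by rewrite mderivM; ring.
Qed.

(** Antisymmetry transfers this and the next two laws from the first argument to the second. *)
Lemma pbracketDr f g h : pb h (f + g) = pb h f + pb h g.
Proof. by rewrite !(pbracket_antisym h) pbracketDl opprD. Qed.

Lemma pbracketZr c f h : pb h (c *: f) = c *: pb h f.
Proof. by rewrite !(pbracket_antisym h) pbracketZl scalerN. Qed.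

Lemma pbracketMr f g h : pb h (f * g) = f * pb h g + pb h f * g.
Proof. by rewrite !(pbracket_antisym h) pbracketMl mulrN mulNr opprD. Qed.

Lemma gen_eq a i b j : (gen a i == gen b j :> 'I_(n + n)) = (a == b) && (i == j).
Proof.
case: a b => [] [] /=; rewrite ?eq_rshift ?eq_lshift //.
- by rewrite eq_rlshift.
- by rewrite eq_lrshift.
Qed.

Lemma mderivXgen (i j : 'I_(n + n)) : ('X_i : P)^`M(j) = (i == j)%:R.
Proof.
rewrite mderivX mnm1E; case: eqP => [->|_]; last by rewrite scale0r.
by rewrite scale1r -[X in 'X_[X]](_ : 0%MM = _) ?mpolyX0 //; apply/mnmP => k;
   rewrite mnmBE subnn mnm0E.
Qed.

(** Partial derivatives of variables are Kronecker deltas, so a single term of the sum survives. *)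
Lemma pbracket_gen a i b j : pb 'X_(gen a i) 'X_(gen b j) = brk a i b j.
Proof.
rewrite pbracketE (bigD1 (a, i)) //= (bigD1 (b, j)) //=.
rewrite !mderivXgen !eqxx !mul1r big1 ?addr0 => [|[b' j'] ne]; last first.
  by rewrite mderivXgen gen_eq andbC andbC -xpair_eqE eq_sym (negPf ne) mulr0 mul0r.
rewrite big1 ?addr0 // => -[a' i'] ne; rewrite big1 // => v _.
by rewrite !mderivXgen /= gen_eq -xpair_eqE eq_sym (negPf ne) !mul0r.
Qed.

(* Half the bracket, so that the commutator of the deformed product is
   [eps * pbracket]. *)
Definition half_bracket f g : P := 2%:R^-1 *: pb f g.

Lemma half_bracketDl f g h :
  half_bracket (f + g) h = half_bracket f h + half_bracket g h.
Proof. by rewrite /half_bracket pbracketDl scalerDr. Qed.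

Lemma half_bracketDr f g h :
  half_bracket h (f + g) = half_bracket h f + half_bracket h g.
Proof. by rewrite /half_bracket pbracketDr scalerDr. Qed.

Lemma half_bracketZl c f h : half_bracket (c *: f) h = c *: half_bracket f h.
Proof. by rewrite /half_bracket pbracketZl !scalerA mulrC. Qed.

Lemma half_bracketZr c f h : half_bracket h (c *: f) = c *: half_bracket h f.
Proof. by rewrite /half_bracket pbracketZr !scalerA mulrC. Qed.

Lemma half_bracketMl f g h :
  half_bracket (f * g) h = f * half_bracket g h + half_bracket f h * g.
Proof. by rewrite /half_bracket pbracketMl scalerDr scalerAr scalerAl. Qed.

Lemma half_bracketMr f g h :
  half_bracket h (f * g) = f * half_bracket h g + half_bracket h f * g.
Proof. by rewrite /half_bracket pbracketMr scalerDr scalerAr scalerAl. Qed.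

Definition half_bider := Bider half_bracketDl half_bracketDr
  half_bracketZl half_bracketZr half_bracketMl half_bracketMr.

Lemma half_bracketB f g : 2%:R != 0 :> C ->
  half_bracket f g = half_bracket g f + pb f g.
Proof.
move=> two0; rewrite /half_bracket (pbracket_antisym g) scalerN.
have half2 : 2%:R^-1 + 2%:R^-1 = 1 :> C by rewrite -mulr2n -[LHS]mulr_natr mulVf.
move: half2; set c := 2%:R^-1 => half2.
by rewrite -[X in _ = _ + X]scale1r -half2 scalerDl addKr.
Qed.

Section Relations.
Variables (Fr : comUnitRingType) (D : pder Fr C).
Variables (tq : 'I_n -> Fr) (tl : 'I_n -> 'I_n -> Fr).
Hypothesis two0 : 2%:R != 0 :> C.
Hypothesis tq1 : forall i, pval D (tq i) = 1.
Hypothesis tl1 : forall i j, pval D (tl i j) = 1.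
Hypothesis tqu : forall i, tq i \is a GRing.unit.
Hypothesis tlu : forall i j, tl i j \is a GRing.unit.
Hypothesis Dtq : forall i, D (tq i) = qp i.
Hypothesis Dtl : forall i j, D (tl i j) = lp i j.

Local Notation B := (deform half_bider D).

(** The parts free of $\epsilon$ agree by commutativity; swapping the factors changes the
    $\epsilon$-part by the full bracket, which [D c] absorbs. *)
Lemma deform_swap f g c : pval D c = 1 -> pb f g = D c *: (g * f) ->
  ((f, 0) : B) * (g, 0) = c *: (((g, 0) : B) * (f, 0)).
Proof.
move=> c1 E; rewrite deformZ !deformM /= !mulr0 !mul0r !add0r c1 !scale1r.
by congr (_, _); [exact: mulrC | rewrite half_bracketB // E].
Qed.

Lemma pder_inv c : c \is a GRing.unit -> pval D c = 1 ->
  pval D c^-1 = 1 /\ D c^-1 = - D c.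
Proof.
move=> cu c1; have ci : pval D c^-1 = 1 by rewrite rmorphV // c1 invr1.
split=> //; have := pder1 D; rewrite -(divrr cu) pderM c1 ci mul1r mulr1.
by move/eqP; rewrite addr_eq0 => /eqP.
Qed.

Lemma deform_sum1 (I : Type) (s : seq I) (Q : pred I) (F : I -> B) :
  (\sum_(i <- s | Q i) F i).1 = \sum_(i <- s | Q i) (F i).1.
Proof. by apply: (big_morph (fun b : B => b.1)). Qed.

(** The relations for [i < j] are instances of [deform_swap]. In the diagonal one [tq i - 1] has
    value $0$ and derivative [qp i], so the content lies in the $\epsilon$-part. *)
Lemma deform_rels :
  rels tq tl (fun i => (Yv C i, 0) : B) (fun i => (Xv C i, 0) : B).
Proof.
split=> [i j lij|i].
  have pv : pval D (tq i * tl i j) = 1 by rewrite rmorphM tq1 tl1 mulr1.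
  have Dv : D (tq i * tl i j) = qp i + lp i j.
    by rewrite pderM tq1 tl1 mul1r mulr1 Dtq Dtl addrC.
  have vu : tq i * tl i j \is a GRing.unit by rewrite unitrM tqu tlu.
  have [pvV DvV] := pder_inv vu pv.
  split; apply: deform_swap; rewrite ?pvV // pbracket_gen /gbrk lij /=.
  - by rewrite Dtl.
  - by rewrite Dtl.
  - by rewrite Dv.
  - by rewrite DvV Dv.
rewrite !deformZ !deformM; congr (_, _) => /=.
  by rewrite rmorphB rmorph1 tq1 scale1r subrr scale0r mulrC subrr.
rewrite deform_sum1 /= !mulr0 !mul0r !add0r rmorphB rmorph1 tq1 subrr.
rewrite scale0r add0r scale1r.
rewrite half_bracketB // pbracket_gen /gbrk ltnn /=.
have -> : D (tq i - 1) = qp i.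
  by have := pderD D (tq i - 1) 1; rewrite subrK pder1 addr0 Dtq.
rewrite Dtq opprD addrACA subrr add0r -scalerBr; congr (_ *: _).
(* The bracket sums over [k <= i], the relation over [k < i]: the term [k = i] cancels against the
   derivative of [tq i] acting on $y_ix_i$. *)
rewrite (bigD1 i) //= [_ * _ + _]addrC addrA addrK; congr (_ + _).
by apply: eq_bigl => k; rewrite ltn_neqAle andbC.
Qed.
End Relations.
End Bracket.

(** * Values and derivatives on the model of $\mathbb F$ *)

Section JetsOfModel.
Variables (C : fieldType) (r : nat) (e : 'I_r -> {poly C}).
Hypothesis e1 : forall k, (e k).[1] = 1.

Lemma inF_etil (s : 'I_r -> int) : inF e (etil e s).
Proof.
(* Positive exponents go to the numerator and negative ones to the denominator; [Negz k] encodes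
   $-(k+1)$, hence [k.+1]. *)
pose pos z := if z is Posz k then k else 0%N.
pose neg z := if z is Negz k then k.+1 else 0%N.
exists (\prod_(j < r) e j ^+ pos (s j)), 0%N, (neg \o s).
rewrite expr0 mul1r !rmorph_prod -prodf_div; apply: eq_bigr => j _ /=.
by rewrite !rmorphXn; case: (s j) => k /=; rewrite expr0 ?divr1 // mul1r.
Qed.

Lemma etilN (s : 'I_r -> int) : etil e s * etil e (fun k => - s k) = 1.
Proof.
rewrite -big_split big1 // => j _ /=.
by rewrite -expfzDr ?tofrac_neq0 ?e1 ?oner_eq0 // subrr.
Qed.

Variables (Fr : comUnitRingType) (iota : {rmorphism Fr -> {fraction {poly C}}}).
Hypothesis iota_im : forall f, inF e f <-> exists g, iota g = f.

Lemma jet1_iota c : jet1 (iota c) (ev1 (iota c)) (deriv1 (iota c)).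
Proof. by apply: (jet1_inF e1); apply/iota_im; exists c. Qed.

(** The choices [ev1] and [deriv1] obey the sum and product rules here because every element of the
    image of [iota] has a jet. *)
Lemma exists_pder : exists D : pder Fr C,
  (forall c, pval D c = ev1 (iota c)) /\ (forall c, D c = deriv1 (iota c)).
Proof.
pose E c := ev1 (iota c).
have J := jet1_iota.
have E0D : nmod_morphism E.
  split=> [|a b]; first by apply: (jet1_ev1 (d := 0)); rewrite rmorph0; exact: jet1_0.
  apply: (@jet1_ev1 _ _ _ (deriv1 (iota a) + deriv1 (iota b))).
  by rewrite rmorphD; exact: jet1D.
have E1M : monoid_morphism E.
  split=> [|a b]; first by apply: (jet1_ev1 (d := 0)); rewrite rmorph1; exact: jet1_1.
  by apply: jet1_ev1; rewrite rmorphM; apply: jet1M; exact: J.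
pose ev : {rmorphism Fr -> C} := HB.pack E
  (GRing.isNmodMorphism.Build Fr C E E0D) (GRing.isMonoidMorphism.Build Fr C E E1M).
have dD a b : deriv1 (iota (a + b)) = deriv1 (iota a) + deriv1 (iota b).
  by apply: jet1_deriv1; rewrite rmorphD; apply: jet1D; exact: J.
have dM a b : deriv1 (iota (a * b)) = ev a * deriv1 (iota b) + deriv1 (iota a) * ev b.
  by apply: jet1_deriv1; rewrite rmorphM; apply: jet1M; exact: J.
by exists (Pder dD dM).
Qed.

Hypothesis iota_inj : injective iota.

(** The inverse has the opposite exponents, so it lies in $\mathbb F$ too and pulls back along
    [iota]. *)
Lemma etil_unit c (s : 'I_r -> int) : iota c = etil e s -> c \is a GRing.unit.
Proof.
move=> cs; have [g gs] := (iota_im _).1 (inF_etil (fun k => - s k)).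
by apply/unitrPr; exists g; apply: iota_inj; rewrite rmorphM rmorph1 cs gs etilN.
Qed.

Lemma ev1_iota_eq0 tF c : iota tF = 'X%:F -> ev1 (iota c) = 0 ->
  exists d, c = (tF - 1) * d.
Proof.
move=> tX c0.
have [g /iota_im[d dg] cg] := inF_ev1_eq0 e1 ((iota_im _).2 (ex_intro _ c erefl)) c0.
exists d; apply: iota_inj; by rewrite cg rmorphM !rmorphB !rmorph1 tX dg.
Qed.
End JetsOfModel.

(** * The semiclassical limit of $A$ *)

Theorem theorem2p9
  (R : realType) (n r : nat)
  (* Q = (q_1,...,q_n) and Lambda = (lambda_ij) *)
  (q : 'I_n -> R[i]) (lam : 'I_n -> 'I_n -> R[i])
  (hq : forall i, q i != 0 /\ q i != 1)
  (hlam0 : forall i j, lam i j != 0)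
  (hlamd : forall i, lam i i = 1)
  (hlams : forall i j, lam i j = (lam j i)^-1)
  (* G(Q,Lambda) is free abelian of rank r with basis eta *)
  (eta : 'I_r -> R[i]) (heta0 : forall k, eta k != 0)
  (heta_free : forall s s' : 'I_r -> int, zprod eta s = zprod eta s' -> s =1 s')
  (sq : 'I_n -> 'I_r -> int) (hsq : forall i, q i = zprod eta (sq i))
  (sl : 'I_n -> 'I_n -> 'I_r -> int) (hsl : forall i j, lam i j = zprod eta (sl i j))
  (heta_gen : forall k, exists (a : 'I_n -> int) (b : 'I_n -> 'I_n -> int),
      eta k = (\prod_(i < n) q i ^ a i) * \prod_(i < n) \prod_(j < n) lam i j ^ b i j)
  (* mu_1, ..., mu_r linearly independent over Q *)
  (mu : 'I_r -> R[i])
  (hmu : forall a : 'I_r -> rat, \sum_(k < r) ratr (a k) * mu k = 0 -> forall k, a k = 0)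
  (* q, not a root of unity *)
  (q0 : R[i]) (hq00 : q0 != 0) (hq01 : q0 != 1)
  (hq0 : forall m : nat, (0 < m)%N -> q0 ^+ m != 1)
  (* the polynomials e_k *)
  (e : 'I_r -> {poly R[i]})
  (he : forall k, [/\ (size (e k) <= 3)%N, (e k).[q0] = eta k, (e k).[1] = 1
                    & ((e k)^`()).[1] = mu k])
  (* a model of the ring F = C[t,t^-1][e_1^-1,...,e_r^-1] embedded in C(t) *)
  (Fr : comUnitRingType) (iota : {rmorphism Fr -> {fraction {poly R[i]}}})
  (hiota_inj : injective iota)
  (hiota_im : forall f, inF e f <-> exists g, iota g = f)
  (tF : Fr) (htF : iota tF = ('X)%:F)
  (tqF : 'I_n -> Fr) (htqF : forall i, iota (tqF i) = etil e (sq i))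
  (tlF : 'I_n -> 'I_n -> Fr) (htlF : forall i j, iota (tlF i j) = etil e (sl i j))
  (* the algebra A presented by generators y_i, x_i and the relations *)
  (A : algType Fr) (y x : 'I_n -> A)
  (hA : presented tqF tlF y x) :
  let qp := fun i => deriv1 (etil e (sq i)) in
  let lp := fun i j => deriv1 (etil e (sl i j)) in
  (* (1) *)
  (forall i, qp i != 0) /\
  (* (2) *)
  (forall i j, lp i j = - lp j i) /\
  (* (3) A/(t-1)A is the Poisson polynomial algebra with the given bracket *)
  (exists pi : A -> {mpoly R[i][n + n]},
     ((forall a b, pi (a + b) = pi a + pi b) /\
      (forall a b, pi (a * b) = pi a * pi b) /\
      pi 1 = 1 /\
      (forall (f : Fr) a, pi (f *: a) = ev1 (iota f) *: pi a)) /\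
     ((forall i, pi (y i) = @Yv R[i] n i) /\ (forall i, pi (x i) = @Xv R[i] n i)) /\
     (forall P, exists a, pi a = P) /\
     (forall a, pi a = 0 <-> exists b, a = (tF - 1) *: b) /\
     (forall a b c, a * b - b * a = (tF - 1) *: c ->
        pbracket qp lp (pi a) (pi b) = pi c)).
Proof.
have e1 k : (e k).[1] = 1 by have [] := he k.
have qpE s : deriv1 (etil e s) = \sum_(k < r) (s k)%:~R * mu k.
  rewrite (jet1_deriv1 (jet1_etil s e1)); apply: eq_bigr => k _.
  by have [_ _ _ ->] := he k.
move=> qp lp; split=> [i|]; last split=> [i j|].
(* A vanishing integer combination of the $\mu_k$ has zero exponents, which would give $q_i=1$. *)
- apply/eqP; rewrite /qp qpE => sum0.
  have s0 k : sq i k = 0.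
    have := hmu (fun k => (sq i k)%:~R); rewrite (eq_bigr (fun k => (sq i k)%:~R * mu k)).
      by move/(_ sum0 k)/eqP; rewrite intr_eq0 => /eqP.
    by move=> l _; rewrite ratr_int.
  have [_ /eqP[]] := hq i; rewrite hsq /zprod big1 // => k _.
  by rewrite s0.
(* Freeness of the $\eta_k$ lifts $\lambda_{ij}=\lambda_{ji}^{-1}$ to the exponents. *)
- have sN k : sl i j k = - sl j i k.
    apply: (heta_free (sl i j) (fun k => - sl j i k)).
    rewrite -hsl hlams hsl /zprod -prodfV; apply: eq_bigr => l _.
    by rewrite -invr_expz.
  rewrite /lp !qpE -sumrN; apply: eq_bigr => k _.
  by rewrite sN mulrNz mulNr.
have [D [Dval Dder]] := exists_pder e1 hiota_im.
have etil_jet c s : iota c = etil e s ->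
    [/\ pval D c = 1, D c = deriv1 (etil e s) & c \is a GRing.unit].
  move=> cs; rewrite Dval Dder cs (jet1_ev1 (jet1_etil s e1)).
  by split=> //; exact: (etil_unit e1 hiota_im hiota_inj cs).
have tq_jet i := etil_jet _ _ (htqF i).
have tl_jet i j := etil_jet _ _ (htlF i j).
have two0 : 2%:R != 0 :> R[i] by rewrite pnatr_eq0.
have relB : rels tqF tlF (fun i => (Yv _ i, 0) : deform (half_bider qp lp) D)
    (fun i => (Xv _ i, 0) : deform (half_bider qp lp) D).
  apply: deform_rels => // [i|i j|i|i j|i|i j].
  1,3,5: by have [] := tq_jet i.
  1-3: by have [] := tl_jet i j.
(* [f] is the morphism $\Phi$ of the overview. *)
have [f [fy fx _]] := hA.2 _ _ _ relB.
pose pi : {rmorphism A -> {mpoly R[i][n + n]}} :=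
  @deform_fst _ _ _ (half_bider qp lp) D \o f.
have piZ c a : pi (c *: a) = pval D c *: pi a by rewrite /pi /= linearZ.
have piy i : pi (y i) = Yv _ i by rewrite /pi /= fy.
have pix i : pi (x i) = Xv _ i by rewrite /pi /= fx.
(* Thus $t-1$ acts on the deformation as $\epsilon$. *)
have jet_t : pval D (tF - 1) = 0 /\ D (tF - 1) = 1.
  have [v d] : pval D tF = 1 /\ D tF = 1.
    rewrite Dval Dder htF (jet1_ev1 (jet1_poly _)) (jet1_deriv1 (jet1_poly _)).
    by rewrite derivX !hornerE.
  split; first by rewrite rmorphB rmorph1 v subrr.
  by have := pderD D (tF - 1) 1; rewrite subrK pder1 addr0 d.
have [ev_t D_t] := jet_t.
have ev_eq0 c : pval D c = 0 -> exists d, c = (tF - 1) * d.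
  by rewrite Dval; exact: ev1_iota_eq0.
have ev_surj c : exists d, pval D d = c.
  have /hiota_im[d dc] : inF e (c%:P)%:F.
    exists c%:P, 0%N, (fun=> 0%N); rewrite big1 => [|k _]; last exact: expr0.
    by rewrite mulr1 expr0 rmorph1 divr1.
  by exists d; rewrite Dval dc (jet1_ev1 (jet1_poly _)) hornerC.
(* One family indexed like the polynomial variables, the $y_i$ before the $x_i$ as in [gen]. *)
pose gens k := match split k with inl i => y i | inr i => x i end.
have gensy i : gens (gen false i) = y i by rewrite /gens (unsplitK (inl i)).
have gensx i : gens (gen true i) = x i by rewrite /gens (unsplitK (inr i)).
have gensP (k : 'I_(n + n)) : exists (a : bool) (i : 'I_n), k = gen a i.
  by rewrite -[k]splitK; case: (split k) => i; [exists false, i | exists true, i].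
have pig k : pi (gens k) = 'X_k.
  by have [a [i ->]] := gensP k; case: a; rewrite ?gensy ?gensx ?piy ?pix.
have gens_ind (S : A -> Prop) : S 1 -> (forall a b, S a -> S b -> S (a + b)) ->
    (forall a b, S a -> S b -> S (a * b)) -> (forall c a, S a -> S (c *: a)) ->
    (forall k, S (gens k)) -> forall a, S a.
  move=> S1 SD SM SZ Sg; apply: (presented_subalg_full S1 SD SM SZ hA) => i.
  - by rewrite -gensy.
  - by rewrite -gensx.
have scale0 c a : pval D c = 0 -> eqmod (tF - 1) (c *: a) 0.
  by move=> /ev_eq0[d ->]; exists (d *: a); rewrite add0r scalerA.
have scale1 c a : pval D c = 1 -> eqmod (tF - 1) (c *: a) a.
  move=> c1; rewrite -[c](subrK 1) scalerDl scale1r -[X in eqmod _ _ X]add0r.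
  by apply: eqmodD; [apply: scale0 | exact: eqmodxx]; rewrite rmorphB rmorph1 c1 subrr.
have [rel_lt rel_diag] := hA.1.
(* Every scalar in these relations has value $1$ at $t=1$, so each becomes a commutation modulo
   $t-1$. *)
have lt_comm a b (i j : 'I_n) : (i < j)%N -> eqmod (tF - 1)
    (gens (gen a j) * gens (gen b i)) (gens (gen b i) * gens (gen a j)).
  move=> /rel_lt[ryy ryx rxy rxx]; have [q1 _ _] := tq_jet i.
  have [l1 _ _] := tl_jet i j; have [l1' _ _] := tl_jet j i.
  have ql1 : pval D (tqF i * tlF i j) = 1 by rewrite rmorphM q1 l1 mulr1.
  have qlu : tqF i * tlF i j \is a GRing.unit.
    by rewrite unitrM; have [_ _ ->] := tq_jet i; have [_ _ ->] := tl_jet i j.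
  by case: a b => [] []; rewrite ?gensx ?gensy ?rxx ?rxy ?ryx ?ryy; apply: scale1;
    rewrite ?rmorphV // ql1 invr1.
have diag_comm i : eqmod (tF - 1) (x i * y i) (y i * x i).
  have [q1 _ _] := tq_jet i.
  rewrite -[x i * y i](subrK (tqF i *: (y i * x i))) rel_diag.
  rewrite -[X in eqmod _ _ X]add0r; apply: eqmodD; last exact: scale1.
  by apply: scale0; rewrite rmorphB rmorph1 q1 subrr.
have gensC k l : eqmod (tF - 1) (gens k * gens l) (gens l * gens k).
  have [[a [i ->]] [b [j ->]]] := (gensP k, gensP l).
  case: (ltngtP i j) => [ij|ji|/val_inj ->]; [exact/eqmod_sym/lt_comm | exact: lt_comm |].
  case: a b => [] []; rewrite ?gensx ?gensy; try exact: eqmodxx.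
  - exact: diag_comm.
  - exact/eqmod_sym/diag_comm.
exists pi; do !split.
- exact: rmorphD.
- exact: rmorphM.
- exact: rmorph1.
- by move=> c a; rewrite piZ Dval.
- exact: piy.
- exact: pix.
- exact: morph_surjective piZ pig ev_surj.
- exact: (morph_kernel gens_ind gensC piZ pig ev_eq0 ev_t).
- by move=> [b ->]; rewrite piZ ev_t scale0r.
move=> a b c E.
have Ef : f a * f b - f b * f a = (tF - 1) *: f c.
  by have := congr1 f E; rewrite rmorphB !rmorphM linearZ.
(* In the $\epsilon$-components the mixed products cancel by commutativity, leaving the bracket on
   the left and [pi c] on the right. *)
have : ((f a).1 * (f b).2 + (f a).2 * (f b).1 + half_bracket qp lp (f a).1 (f b).1)
     - ((f b).1 * (f a).2 + (f b).2 * (f a).1 + half_bracket qp lp (f b).1 (f a).1)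
     = pval D (tF - 1) *: (f c).2 + D (tF - 1) *: (f c).1.
  exact: (congr1 (fun z : deform _ _ => z.2) Ef).
rewrite ev_t D_t scale0r add0r scale1r half_bracketB // => E2.
by rewrite /pi /= /deform_fst -E2; ring.
Qed.
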